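(* Let $X$ be a set and $T:X\to X$ a function. For $x\in X$ and $\Delta\in\mathcal{FP}(X)$, let $$\Delta(x):=\{D\in\Delta: \{n\in\mathbb{N}: T^n(x)\in D\}\text{ is infinite}\}.$$ Then for each $x\in X$, $$\varprojlim_{\Delta\in\mathcal{FP}(X)}\Delta(x)\neq\emptyset.$$
   Context: $T^n$ denotes the $n$-fold iterate of $T$. $\mathcal{FP}(X)$ denotes the set of finite partitions of $X$ (finite sets $\Delta$ of nonempty, pairwise disjoint subsets of $X$ with union $X$). It is partially ordered by refinement: $\Delta'\leq\Delta$ if and only if for every $D'\in\Delta'$ there is a unique $D\in\Delta$ with $D'\subset D$. For fixed $x$ and $\Delta'\leq\Delta$ in $\mathcal{FP}(X)$, the transition map $\Delta'(x)\to\Delta(x)$ sends $A\in\Delta'(x)$ to the unique $B\in\Delta$ with $A\subset B$ (which lies in $\Delta(x)$). The inverse limit is taken in the category of sets: for an inverse family $(X_i,f_{ij}:X_i\to X_j)$, $\varprojlim X_i=\{(a_i)\in\prod X_i: a_j=f_{ij}(a_i)\text{ for all } f_{ij}\}$. *)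

(* Defs.v *)
From mathcomp Require Import all_boot.
From mathcomp Require Import boolp classical_sets functions cardinality.

Set Implicit Arguments.
Unset Strict Implicit.
Unset Printing Implicit Defensive.

Local Open Scope classical_set_scope.

(* Covariant in [le]: [imap] goes from the [le]-smaller index to the larger. *)
Record inverse_system (I : Type) (le : I -> I -> Prop) := InverseSystem {
  iobj :> I -> Type;
  imap : forall i j, le i j -> iobj i -> iobj j;
  imap_id : forall i (h : le i i) a, imap h a = a;
  imap_comp : forall i j k (hij : le i j) (hjk : le j k) (hik : le i k) a,
    imap hjk (imap hij a) = imap hik a }.

Definition inverse_limit (I : Type) (le : I -> I -> Prop)
    (S : inverse_system le) : set (forall i, S i) :=
  [set a | forall i j (h : le i j), a j = imap h (a i)].
Arguments inverse_limit {I le} S.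

Record finpart (X : Type) := FinPart {
  blocks : set (set X);
  finpart_finite : finite_set blocks;
  finpart_partition : partition blocks id [set: X] }.

Section Refinement.
Variable X : Type.
Implicit Types P Q R : finpart X.

Definition refines P Q : Prop :=
  forall A, blocks P A -> exists! B : set X, blocks Q B /\ A `<=` B.

Lemma finpart_uniq Q (A B C : set X) : A !=set0 ->
  blocks Q B -> blocks Q C -> A `<=` B -> A `<=` C -> B = C.
Proof.
move=> [x Ax] QB QC AB AC; have [_ tI _] := finpart_partition Q.
by apply: tI => //; exists x; split; [exact: AB | exact: AC].
Qed.

Lemma finpart_neq0 P A : blocks P A -> A !=set0.
Proof. by have [_ _] := finpart_partition P; exact. Qed.

Lemma refines_refl P : refines P P.
Proof.
move=> A PA; exists A; split; first by split.
move=> B [PB AB].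
exact: (finpart_uniq (finpart_neq0 PA) PA PB (@subset_refl _ A)).
Qed.

Lemma refines_trans P Q R : refines P Q -> refines Q R -> refines P R.
Proof.
move=> PQ QR A PA; have [B [[QB AB] _]] := PQ A PA.
have [C [[RC BC] _]] := QR B QB.
have AC : A `<=` C by exact: subset_trans AB BC.
exists C; split=> // C' [RC' AC'].
exact: (finpart_uniq (finpart_neq0 PA) RC RC').
Qed.

Lemma refines_anti P Q : refines P Q -> refines Q P -> P = Q.
Proof.
have sub P' Q' : refines P' Q' -> refines Q' P' -> blocks P' `<=` blocks Q'.
  move=> PQ QP A PA; have [B [[QB AB] _]] := PQ A PA.
  have [C [[PC BC] _]] := QP B QB.
  have AC : A = C.
    by apply: (finpart_uniq (finpart_neq0 PA) PA PC) => // x /AB /BC.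
  by rewrite (_ : A = B)//; apply/seteqP; split=> //; rewrite AC.
move=> PQ QP; have : blocks P = blocks Q by apply/seteqP; split; exact: sub.
case: P Q {PQ QP} => [p fp pp] [q fq pq] /= e.
by case: _ / e in fq pq *; congr FinPart; exact: Prop_irrelevance.
Qed.

End Refinement.

Section Recurrence.
Variables (X : Type) (T : X -> X) (x : X).
Implicit Types P Q R : finpart X.

Definition recurrent P : set (set X) :=
  [set D | blocks P D /\ infinite_set [set n : nat | D (iter n T x)]].

Definition recurrent_type P : Type := {D : set X | recurrent P D}.

Definition transition_block P Q (h : refines P Q) (A : recurrent_type P) :
  set X := projT1 (cid (h (sval A) (svalP A).1)).

Lemma transition_blockP P Q (h : refines P Q) (A : recurrent_type P) :
  blocks Q (transition_block h A) /\ sval A `<=` transition_block h A.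
Proof. by rewrite /transition_block; case: cid => B []. Qed.

Lemma transition_recurrent P Q (h : refines P Q) (A : recurrent_type P) :
  recurrent Q (transition_block h A).
Proof.
have [QB AB] := transition_blockP h A; split=> //.
by apply: contra_not (svalP A).2 => fB; apply: sub_finite_set fB => n /AB.
Qed.

Definition transition P Q (h : refines P Q) (A : recurrent_type P) :
  recurrent_type Q := exist _ _ (transition_recurrent h A).

Lemma transition_eq P Q (h : refines P Q) (A : recurrent_type P)
  (B : recurrent_type Q) : sval A `<=` sval B -> transition h A = B.
Proof.
move=> AB; apply: eq_sig_hprop => [D|/=]; first exact: Prop_irrelevance.
have [QC AC] := transition_blockP h A.
exact: (finpart_uniq (finpart_neq0 (svalP A).1) QC (svalP B).1).
Qed.

Lemma transition_id P (h : refines P P) A : transition h A = A.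
Proof. exact: transition_eq. Qed.

Lemma transition_comp P Q R (hPQ : refines P Q) (hQR : refines Q R)
  (hPR : refines P R) A : transition hQR (transition hPQ A) = transition hPR A.
Proof.
apply/esym/transition_eq => y Ay.
by apply: (transition_blockP hQR _).2; apply: (transition_blockP hPQ _).2.
Qed.

Definition recurrent_system : inverse_system (@refines X) :=
  InverseSystem transition_id transition_comp.

End Recurrence.

(* Main.v *)
Require Import Defs.
From mathcomp Require Import all_boot.
From mathcomp Require Import boolp classical_sets functions cardinality.
From mathcomp Require Import filter.

(** Fix a free ultrafilter [U] on the set of times: one that refines the
    cofinite filter ([ultraFilterLemma] applied to [frechet_properfilter_nat]).  Pull it
    back along the orbit of [x]: call a set [D] large when the times at which
    the orbit visits [D] belong to [U].

    Every finite partition of [X] has a large block, because an ultrafilter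
    that contains a finite union contains one of its members
    ([ultra_bigcup_finite]), and this block is recurrent because a set in a
    free ultrafilter is infinite.  Two large sets always meet.  Hence, when one
    partition refines another, the block containing the large block of the
    finer partition and the large block of the coarser one have a common point,
    so they coincide.  The choice of the large block in every partition is
    therefore compatible with the transition maps: it is a point of the inverse
    limit. *)

Set Implicit Arguments.
Unset Strict Implicit.
Unset Printing Implicit Defensive.

Local Open Scope classical_set_scope.

Lemma free_filter_infinite (T : Type) (F : set_system T) (A : set T) :
  ProperFilter F -> @frechet_filter T `<=` F -> F A -> infinite_set A.
Proof.
move=> PF freeF FA finA; have FCA : F (~` A).
  by apply: freeF; rewrite /frechet_filter /= setCK.
by have [t []] := filter_ex (filterI FA FCA).
Qed.

(** If no member were in the ultrafilter, all their complements would be, and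
    so would the finite intersection of these, which is disjoint from the
    union. *)
Lemma ultra_bigcup_finite (T I : Type) (F : set_system T) (D : set I)
    (f : I -> set T) : UltraFilter F -> finite_set D ->
  F (\bigcup_(i in D) f i) -> exists2 i, D i & F (f i).
Proof.
move=> UF finD FU; apply: contrapT => noF.
have FC i : D i -> F (~` f i).
  by move=> Di; have [Ffi|//] := in_ultra_setVsetC (f i) UF; case: noF; exists i.
have FI : F (\bigcap_(i in D) ~` f i).
  have /(@finite_fsetP {classic I})[E DE] := finD.
  rewrite DE; apply: (@filter_bigI T {classic I}) => i Ei.
  by apply: FC; rewrite DE.
by have [t [[i Di fit] /(_ i Di)]] := filter_ex (filterI FU FI).
Qed.

Section LargeBlock.
Variables (X : Type) (T : X -> X) (x : X) (U : set_system nat).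
Hypotheses (UU : UltraFilter U) (freeU : @frechet_filter nat `<=` U).

Let visits (D : set X) : set nat := [set n | D (iter n T x)].

Lemma exists_large_block (P : finpart X) :
  exists A : recurrent_type T x P, U (visits (sval A)).
Proof.
have [cov _ _] := finpart_partition P.
have [|D PD UD] := ultra_bigcup_finite (f := visits) UU (finpart_finite P).
  apply: filterS (filterT : U setT) => n _.
  by have : cover (blocks P) id (iter n T x) by rewrite cov.
have recD : recurrent T x P D.
  by split=> //; exact: (free_filter_infinite _ freeU UD).
by exists (exist _ D recD).
Qed.

(** A time at which the orbit visits both [A] and [B] gives a common point of
    [B] and of the block of [Q] that contains [A]. *)
Lemma transition_large_block (P Q : finpart X) (h : refines P Q)
    (A : recurrent_type T x P) (B : recurrent_type T x Q) :
  U (visits (sval A)) -> U (visits (sval B)) -> transition h A = B.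
Proof.
move=> UA UB; apply: transition_eq.
have [QC AC] := transition_blockP h A.
have [_ tI _] := finpart_partition Q.
have [n [An Bn]] := filter_ex (filterI UA UB).
suff <- : transition_block h A = sval B by [].
apply: tI => //; first exact: (svalP B).1.
by exists (iter n T x); split; [exact: AC|].
Qed.

End LargeBlock.

Theorem corollary5 (X : Type) (T : X -> X) (x : X) :
  (inverse_limit (recurrent_system T x) !=set0)%classic.
Proof.
have [U [UU freeU]] := ultraFilterLemma frechet_properfilter_nat.
have largeP := exists_large_block T x UU freeU.
exists (fun P => projT1 (cid (largeP P))) => P Q h /=.
case: (cid (largeP P)) (cid (largeP Q)) => A UA [B UB] /=.
by rewrite (transition_large_block UU h UA UB).
Qed.
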